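(* Let $\Gamma\in\mathbb R^{K\times K}$ be symmetric positive definite and let $h\colon\mathbb R^d\to\mathbb R^K$ be continuous with $|h(u)|\le\kappa_h$ for all $u\in\mathbb R^d$, where $\kappa_h>0$. Then for all $\mu,\nu\in\mathcal P^2(\mathbb R^d)$, $$d_g(\mathsf Q\mu,\mathsf Q\nu)\le\bigl(1+\kappa_h^2+\operatorname{tr}(\Gamma)\bigr)\,d_g(\mu,\nu).$$
   Context: $|\cdot|$ is the Euclidean norm. $\mathcal P^2(\mathbb R^n)$ is the set of Borel probability measures with finite second moment. With $g(v)=1+|v|^2$ on $\mathbb R^n$ (here $n=d$ or $n=d+K$), $d_g(\mu_1,\mu_2)=\sup_{|f|\le g}\left|\int f\,d\mu_1-\int f\,d\mu_2\right|$ for $\mu_1,\mu_2\in\mathcal P^2(\mathbb R^n)$, the supremum being over measurable $f$ with $|f|\le g$ pointwise. For a probability measure $\mu$ on $\mathbb R^d$, $\mathsf Q\mu$ is the law on $\mathbb R^d\times\mathbb R^K$ of $(U,h(U)+\eta)$ with $U\sim\mu$ and $\eta\sim\mathcal N(0,\Gamma)$ independent; if $\mu$ has a density then $\mathsf Q\mu(u,y)=\frac{1}{\sqrt{(2\pi)^K\det\Gamma}}\exp\left(-\tfrac12|\Gamma^{-1/2}(y-h(u))|^2\right)\mu(u)$. *)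

(* Defs.v *)
(* MathComp-Analysis; R^n is the type 'rV[R]_n of row vectors. *)
From HB Require Import structures.
From mathcomp Require Import all_boot all_order all_algebra.
From mathcomp Require Import all_classical all_reals all_analysis.

Set Implicit Arguments.
Unset Strict Implicit.
Unset Printing Implicit Defensive.

Import Order.TTheory GRing.Theory Num.Theory.
Import numFieldNormedType.Exports.

Local Open Scope classical_set_scope.
Local Open Scope ring_scope.

(* Borel sigma-algebra of 'M[R]_(m, n), hence of R^n = 'M[R]_(1, n). The
   library's topology on matrices is the entrywise one, i.e. the Euclidean
   topology. *)
HB.instance Definition _ (R : realType) (m n : nat) :=
  @isMeasurable.Build (sigma_display (@open 'M[R]_(m, n))) 'M[R]_(m, n)
    <<s @open 'M[R]_(m, n) >>
    (@sigma_algebra0 _ setT (@open 'M[R]_(m, n)))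
    (@sigma_algebraC _ (@open 'M[R]_(m, n)))
    (@sigma_algebra_bigcup _ setT (@open 'M[R]_(m, n))).

(* The library's norm `|v| on matrices is the maximum norm, so the Euclidean
   norm has to be introduced separately. *)
Definition enorm (R : realType) (n : nat) (v : 'rV[R]_n) : R :=
  Num.sqrt (\sum_(i < n) v 0 i ^+ 2).

Definition gfun (R : realType) (n : nat) (v : 'rV[R]_n) : R :=
  1 + enorm v ^+ 2.

Definition P2 (R : realType) (n : nat) : set (probability 'rV[R]_n R) :=
  [set mu | (\int[mu]_v (enorm v ^+ 2)%:E < +oo)%E].

(* Like the library's integral and pushforward, d_g takes bare set functions, so
   that no measurability proof enters the statement of the bound. The supremum is
   taken in \bar R. *)
Definition d_g (R : realType) (n : nat) (mu1 mu2 : set 'rV[R]_n -> \bar R) :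
    \bar R :=
  ereal_sup
    [set `|\int[mu1]_v (f v)%:E - \int[mu2]_v (f v)%:E|%E | f in
      [set f : 'rV[R]_n -> R |
        measurable_fun [set: 'rV[R]_n] f /\ forall v, `|f v| <= gfun v]].

Definition posdefmx (R : realType) (n : nat) (A : 'M[R]_n) : Prop :=
  forall v : 'rV[R]_n, v != 0 -> 0 < (v *m A *m v^T) 0 0.

(* Lebesgue measure on R^n, as an iterated product under the identification
   of R * R^n with R^(n+1). *)
Fixpoint lebesgue_rV (R : realType) (n : nat) : set 'rV[R]_n -> \bar R :=
  match n return set 'rV[R]_n -> \bar R with
  | 0 => \d_(0 : 'rV[R]_0)
  | n'.+1 =>
      pushforward (@lebesgue_measure R \x @lebesgue_rV R n')%E
        (fun p : R * 'rV[R]_n' => row_mx p.1%:M p.2 : 'rV[R]_(n'.+1))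
  end.

(* Density of N(0, Gam): the quadratic form y Gam^-1 y^T in the exponent is the
   squared Euclidean norm of Gam^(-1/2) y. *)
Definition gauss_pdf (R : realType) (n : nat) (Gam : 'M[R]_n) (y : 'rV[R]_n) :
    R :=
  (Num.sqrt ((2 * pi) ^+ n * \det Gam))^-1 *
  expR (- (1 / 2) * (y *m invmx Gam *m y^T) 0 0).

Definition gauss (R : realType) (n : nat) (Gam : 'M[R]_n) :
    set 'rV[R]_n -> \bar R :=
  fun A => (\int[@lebesgue_rV R n]_(y in A) (gauss_pdf Gam y)%:E)%E.

(* Law of (U, h U + eta) when (U, eta) has law mu \x N(0, Gam), i.e. when
   U ~ mu and eta ~ N(0, Gam) are independent; R^d * R^K is R^(d+K). *)
Definition Qop (R : realType) (d K : nat) (h : 'rV[R]_d -> 'rV[R]_K)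
    (Gam : 'M[R]_K) (mu : set 'rV[R]_d -> \bar R) :
    set 'rV[R]_(d + K) -> \bar R :=
  pushforward (mu \x gauss Gam)%E
    (fun p : 'rV[R]_d * 'rV[R]_K => row_mx p.1 (h p.1 + p.2)).

(* Main.v *)
Require Import Defs.
From HB Require Import structures.
From mathcomp Require Import all_boot all_order all_algebra.
From mathcomp Require Import all_classical all_reals all_analysis.
From mathcomp Require Import measurable_realfun.
From mathcomp Require Import ring lra.

Set Implicit Arguments.
Unset Strict Implicit.
Unset Printing Implicit Defensive.

Import Order.TTheory GRing.Theory Num.Theory.
Import numFieldNormedType.Exports.

Local Open Scope classical_set_scope.
Local Open Scope ring_scope.

(** Write C = 1 + kappa^2 + tr Gam and let eta have law N(0, Gam). Integrating a
    test function f on R^d x R^K over the noise gives a function of u alone,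
    F u = E f(u, h u + eta), and Fubini turns the integral of f against Q mu
    into the integral of F against mu. The second moment of the Gaussian gives
      E (1 + |u|^2 + |h u + eta|^2) = 1 + |u|^2 + |h u|^2 + tr Gam
        <= C (1 + |u|^2),
    so |f| <= g implies |F| <= C g: F / C is a test function for d_g mu nu, and
    the discrepancy of Q mu and Q nu on f is C times the discrepancy of mu and
    nu on F / C. This is [observation_average]; taking the supremum over f is
    all that remains for the theorem.

    The substance is that N(0, Gam), given by its density against the iterated
    product of Lebesgue measures, is a probability with E |v + eta|^2 =
    |v|^2 + tr Gam ([gauss_probability]). Both facts are instances of one
    formula: for P symmetric positive definite, the integral over R^n of
    (c + <y, q P>)^2 exp (- <y, y P> / 2) is
    sqrt ((2 pi)^n / det P) * (c^2 + <q, q P>)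
    ([gaussian_quadratic_integral]; c = 1, q = 0 is the mass). It is proved by
    induction on n. Completing the square in the first coordinate x of
    y = (x, z) leaves a one-dimensional Gaussian integral in x, and in z the
    same kind of integral for the Schur complement S of P, where
    det P = P_00 det S. All integrands are nonnegative, so Tonelli suffices, and
    no change of variables in R^n is required. The one-dimensional formula is
    obtained from the library's Gauss integral and from the primitive
    (int_0^x exp (- t^2) dt - x exp (- x^2)) / 2 of x^2 exp (- x^2).

    Underneath lies the fact that a map into R^n with measurable coordinates is
    Borel measurable ([measurable_fun_mx]), which connects the Borel
    sigma-algebra of R^n, used for all the laws, with the product
    sigma-algebras on which Fubini works. *)

(** * Borel measurability of matrix-valued maps *)

Lemma open_mx_rational_boxes (R : realType) (m n : nat) (U : set 'M[R]_(m, n)) :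
  open U ->
  let box (c : 'M[rat]_(m, n) * 'M[rat]_(m, n)) := [set y : 'M[R]_(m, n) |
    forall i j, `]ratr (c.1 i j), ratr (c.2 i j)[%classic (y i j)] in
  U = \bigcup_(c in [set c | box c `<=` U]) box c.
Proof.
move=> oU box; apply/seteqP; split => [x Ux|x [c cU]]; last exact: cU.
have /nbhs_ballP[e /= e0 eU] : nbhs x U by exact: open_nbhs_nbhs.
have lo i j : exists q : rat, x i j - e < ratr q < x i j.
  have [q] := @rat_in_itvoo R (x i j - e) (x i j) ltac:(lra).
  by rewrite in_itv/=; exists q.
have hi i j : exists q : rat, x i j < ratr q < x i j + e.
  have [q] := @rat_in_itvoo R (x i j) (x i j + e) ltac:(lra).
  by rewrite in_itv/=; exists q.
exists (\matrix_(i, j) xchoose (lo i j), \matrix_(i, j) xchoose (hi i j));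
  last first.
  move=> i j /=; rewrite !mxE in_itv/=.
  by have /andP[_ ->] := xchooseP (lo i j); have /andP[->] := xchooseP (hi i j).
move=> y yc; apply: eU; split=> // i j; move: (yc i j) => /=.
rewrite !mxE in_itv/=.
have := xchooseP (lo i j); have := xchooseP (hi i j).
by rewrite /ball/= ltr_norml; lra.
Qed.

(** Countably many boxes with rational corners generate the topology, and the
    preimage of a box is a finite intersection of conditions on entries. *)
Lemma measurable_fun_mx (R : realType) (m n : nat) d (T : measurableType d)
    (f : T -> 'M[R]_(m, n)) :
  (forall i j, measurable_fun setT (fun x => f x i j)) ->
  measurable_fun setT f.
Proof.
move=> mf; apply: (measurability (@open 'M[R]_(m, n))) => //.
move=> _ [U oU <-]; rewrite setTI (open_mx_rational_boxes oU) preimage_bigcup.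
rewrite bigcup_mkcond; apply: countable_bigcupT_measurable => // c.
case: ifPn => // _.
pose I i j :=
  (fun x => f x i j) @^-1` `]ratr (c.1 i j), ratr (c.2 i j)[%classic.
suff -> : f @^-1` [set y | forall i j,
      `]ratr (c.1 i j), ratr (c.2 i j)[%classic (y i j)] =
    \bigcap_(i in [set: 'I_m]) \bigcap_(j in [set: 'I_n]) I i j.
  apply: fin_bigcap_measurable => // i _.
  apply: fin_bigcap_measurable => // j _.
  by rewrite -[I i j]setTI; exact: mf.
apply/seteqP; split=> x /= H i; first by move=> _ j _; exact: H.
by move=> j; exact: (H i).
Qed.

Lemma continuous_measurable_fun_mx (R : realType) (m n p q : nat)
    (f : 'M[R]_(m, n) -> 'M[R]_(p, q)) :
  continuous f -> measurable_fun setT f.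
Proof.
move=> /continuousP cf; apply: (measurability (@open 'M[R]_(p, q))) => //.
by move=> _ [U oU <-]; rewrite setTI; apply: sub_sigma_algebra; exact: cf.
Qed.

Lemma measurable_fun_coord (R : realType) (m n : nat) (i : 'I_m) (j : 'I_n) :
  measurable_fun setT (fun M : 'M[R]_(m, n) => M i j).
Proof.
apply: (measurability _ (measurable_realfun.RGenOpens.measurableE R)).
move=> _ [_ [a [b ->] <-]].
rewrite setTI; apply: sub_sigma_algebra.
have /continuousP : continuous (fun M : 'M[R]_(m, n) => M i j).
  exact: coord_continuous.
by apply; exact: interval_open.
Qed.

Lemma measurable_row_mx (R : realType) (m n : nat) d (T : measurableType d)
    (f : T -> 'rV[R]_m) (g : T -> 'rV[R]_n) :
  measurable_fun setT f -> measurable_fun setT g ->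
  measurable_fun setT (fun x => row_mx (f x) (g x)).
Proof.
move=> mf mg; apply: measurable_fun_mx => i j; case: (split_ordP j) => k ->.
- under eq_fun do rewrite row_mxEl.
  exact: (measurableT_comp (measurable_fun_coord i k)).
- under eq_fun do rewrite row_mxEr.
  exact: (measurableT_comp (measurable_fun_coord i k)).
Qed.

Lemma measurable_mulmx (R : realType) m n p d (T : measurableType d)
    (f : T -> 'M[R]_(m, n)) (g : T -> 'M[R]_(n, p)) :
  measurable_fun setT f -> measurable_fun setT g ->
  measurable_fun setT (fun x => f x *m g x).
Proof.
move=> mf mg; apply: measurable_fun_mx => i j; under eq_fun do rewrite mxE.
apply: measurable_sum => k.
by apply: measurable_funM; exact: measurableT_comp (measurable_fun_coord _ _) _.
Qed.

Lemma measurable_trmx (R : realType) m n d (T : measurableType d)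
    (f : T -> 'M[R]_(m, n)) :
  measurable_fun setT f -> measurable_fun setT (fun x => (f x)^T).
Proof.
move=> mf; apply: measurable_fun_mx => i j; under eq_fun do rewrite mxE.
exact: measurableT_comp (measurable_fun_coord _ _) _.
Qed.

Lemma measurable_addmx (R : realType) m n d (T : measurableType d)
    (f g : T -> 'M[R]_(m, n)) :
  measurable_fun setT f -> measurable_fun setT g ->
  measurable_fun setT (fun x => f x + g x).
Proof.
move=> mf mg; apply: measurable_fun_mx => i j; under eq_fun do rewrite mxE.
by apply: measurable_funD; exact: measurableT_comp (measurable_fun_coord _ _) _.
Qed.

(** * Lebesgue measure on row vectors *)

(** The measures below are existentially quantified because the definitions
    they describe are bare set functions: equating such a function with a
    bundled measure is what gives access to the theory of integration. *)
Lemma sigma_finite_measure_ex d (T : measurableType d) (R : realType)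
    (mu : {measure set T -> \bar R}) : sigma_finite setT mu ->
  exists m : {sigma_finite_measure set T -> \bar R},
    (mu : set T -> \bar R) = m.
Proof.
move=> sf; have sfi := sfinite_measure_sigma_finite sf.
pose Q : {sigma_finite_measure set T -> \bar R} :=
  HB.pack (Measure.sort mu)
    (@isSFinite.Build _ _ _ (Measure.sort mu) sfi)
    (@isSigmaFinite.Build _ _ _ (Measure.sort mu) sf).
by exists Q.
Qed.

Lemma pushforward_measure_ex d d' (T : measurableType d)
    (T' : measurableType d') (R : realType) (mu : {measure set T -> \bar R})
    (f : T -> T') :
  measurable_fun setT f ->
  exists m : {measure set T' -> \bar R}, pushforward mu f = m.
Proof. by move=> mf; eexists; reflexivity. Unshelve. exact: mf. Qed.

Lemma product_measure_ex d1 d2 (T1 : measurableType d1)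
    (T2 : measurableType d2) (R : realType)
    (m1 : {sigma_finite_measure set T1 -> \bar R})
    (m2 : {sigma_finite_measure set T2 -> \bar R}) :
  exists m : {sigma_finite_measure set (T1 * T2)%type -> \bar R},
    (m1 \x m2)%E = m.
Proof.
pose P : {measure set (T1 * T2)%type -> \bar R} := (m1 \x m2)%E.
apply: (@sigma_finite_measure_ex _ _ _ P).
have /sigma_finiteP[A [coverA homoA finA]] := sigma_finiteT m1.
have /sigma_finiteP[B [coverB homoB finB]] := sigma_finiteT m2.
exists (fun k => A k `*` B k) => [|k].
  apply/seteqP; split=> // -[x y] _.
  have [i _ Aix] : (\bigcup_k A k) x by rewrite -coverA.
  have [j _ Bjy] : (\bigcup_k B k) y by rewrite -coverB.
  exists (maxn i j) => //; split.
    by move/subsetPset: (homoA _ _ (leq_maxl i j)); exact.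
  by move/subsetPset: (homoB _ _ (leq_maxr i j)); exact.
have [mA Afin] := finA k; have [mB Bfin] := finB k.
split; first exact: measurableX.
by rewrite /= product_measure1E// lte_mul_pinfty// ge0_fin_numE.
Qed.

Lemma measurable_scalar_mx1 (R : realType) :
  measurable_fun setT (fun x : R => x%:M : 'rV[R]_1).
Proof.
apply: measurable_fun_mx => i j; under eq_fun do rewrite mxE !ord1 eqxx mulr1n.
exact: measurable_id.
Qed.

Definition vcons (R : realType) n (p : R * 'rV[R]_n) : 'rV[R]_n.+1 :=
  row_mx p.1%:M p.2 : 'rV[R]_(1 + n).

(** The source carries the measurable structure on which the library defines
    [lebesgue_measure]. *)
Lemma measurable_vcons (R : realType) n :
  measurable_fun setT
    (@vcons R n : measurableTypeR R * 'rV[R]_n -> 'rV[R]_n.+1).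
Proof.
have H := @measurable_row_mx R 1 n _ (measurableTypeR R * 'rV[R]_n)%type
  (fun p => p.1%:M) snd.
exact: H (measurableT_comp (@measurable_scalar_mx1 R) measurable_fst)
  measurable_snd.
Qed.

Lemma lebesgue_rVS (R : realType) n : @lebesgue_rV R n.+1 =
  pushforward (@lebesgue_measure R \x @lebesgue_rV R n)%E (@vcons R n).
Proof. by []. Qed.

Lemma lebesgue_rV_sigma_finite (R : realType) n :
  exists m : {sigma_finite_measure set 'rV[R]_n -> \bar R},
    @lebesgue_rV R n = m.
Proof.
elim: n => [|n [m E]].
  by exists (\d_(0 : 'rV[R]_0) : {sigma_finite_measure set 'rV[R]_0 -> \bar R}).
rewrite lebesgue_rVS E.
pose L : {sigma_finite_measure set (measurableTypeR R) -> \bar R} :=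
  lebesgue_measure.
have [P EP] := product_measure_ex L m.
have [Q EQ] :=
  @pushforward_measure_ex _ _ _ _ _ P (@vcons R n) (@measurable_vcons R n).
have [|S ES] := @sigma_finite_measure_ex _ _ _ Q; last first.
  by exists S; rewrite -ES -EQ; congr (pushforward _ _); exact: EP.
rewrite -EQ.
have /sigma_finiteP[F [TF _ Foo]] := sigma_finiteT P.
(* A sigma-finite exhaustion is transported through the inverse of vcons. *)
pose g (y : 'rV[R]_n.+1) : measurableTypeR R * 'rV[R]_n :=
  ((y : 'rV[R]_(1 + n)) 0 (lshift n 0), rsubmx (y : 'rV[R]_(1 + n))).
have mg : measurable_fun setT g.
  apply/measurable_fun_pairP; split; first exact: measurable_fun_coord.
  apply: measurable_fun_mx => i j; rewrite /=.
  under eq_fun do rewrite mxE; exact: measurable_fun_coord.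
have fK : cancel (@vcons R n) g.
  move=> [x y]; rewrite /g /= /vcons row_mxKr row_mxEl /=.
  by rewrite mxE eqxx mulr1n.
exists (fun k => g @^-1` F k).
  by rewrite -preimage_bigcup -TF preimage_setT.
move=> k; have [mF Fk] := Foo k; split.
  by rewrite -[_ @^-1` _]setTI; exact: mg.
rewrite /pushforward -comp_preimage (_ : g \o @vcons R n = id) //.
by apply/funext => x; exact: fK.
Qed.

Lemma ge0_integral_rVS (R : realType) n (f : 'rV[R]_n.+1 -> \bar R) :
  measurable_fun [set: 'rV[R]_n.+1] f -> (forall y, 0 <= f y)%E ->
  (\int[@lebesgue_rV R n.+1]_y f y =
   \int[@lebesgue_rV R n]_z \int[lebesgue_measure]_x f (vcons (x, z)))%E.
Proof.
move=> mf f0; have [m E] := @lebesgue_rV_sigma_finite R n.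
pose L : {sigma_finite_measure set (measurableTypeR R) -> \bar R} :=
  lebesgue_measure.
have [P EP] := product_measure_ex L m.
rewrite lebesgue_rVS E.
transitivity (\int[pushforward P (@vcons R n)]_y f y)%E.
  exact: (congr1 (fun M => \int[pushforward M (@vcons R n)]_y f y)%E EP).
rewrite ge0_integral_pushforward//; last exact: measurable_vcons.
transitivity (\int[(L \x m)%E]_x (f \o @vcons R n) x)%E.
  by rewrite preimage_setT; congr (integral _ _ _); exact/esym/EP.
rewrite fubini_tonelli2//; last by move=> x; exact: f0.
by apply: measurableT_comp => //; exact: measurable_vcons.
Qed.

Lemma integral_rV0 (R : realType) (f : 'rV[R]_0 -> \bar R) :
  measurable_fun setT f -> (\int[@lebesgue_rV R 0]_y f y = f 0%R)%E.
Proof. by move=> mf; rewrite /= integral_dirac// diracT mul1e. Qed.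

(** * Gaussian integrals on the line *)

Lemma cvg_x_gauss_fun (R : realType) :
  x * gauss_fun x @[x --> +oo%R] --> (0 : R).
Proof.
apply: (@squeeze_cvgr _ _ _ _ (cst 0) (fun x : R => x^-1)).
- near=> x; have x0 : 0 < x by near: x; exact: nbhs_pinfty_gt.
  apply/andP; split; first by rewrite /= mulr_ge0 ?gauss_fun_ge0// ltW.
  rewrite /gauss_fun expRN -[leRHS]mul1r ler_pdivrMr ?expR_gt0//.
  rewrite mulrAC mul1r ler_pdivlMr// -expr2.
  (* x^2 <= exp (x^2) *)
  by apply: le_trans (expR_ge1Dx _); rewrite lerDr.
- exact: cvg_cst.
- by apply/gtr0_cvgV0; [near=> x; near: x; exact: nbhs_pinfty_gt|exact: cvg_id].
Unshelve. all: end_near. Qed.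

Lemma cvg_integral0_gauss (R : realType) :
  gauss_integral_proof.integral0_gauss x @[x --> +oo%R]
    --> (Num.sqrt pi / 2 : R).
Proof.
have : Num.sqrt (@gauss_integral_proof.integral0_gauss R x ^+ 2) @[x --> +oo]
      --> Num.sqrt (pi / 4).
  apply: continuous_cvg => //; first exact: sqrt_continuous.
  exact: gauss_integral_proof.cvg_integral0_gauss_sqr.
have -> : (4 : R) = 2 ^+ 2 by rewrite expr2 -natrM.
rewrite sqrtrM ?pi_ge0// sqrtrV ?exprn_ge0// sqrtr_sqr ger0_norm//.
apply: cvg_trans; apply: near_eq_cvg; apply: nearW => r.
by rewrite sqrtr_sqr ger0_norm// gauss_integral_proof.integral0_gauss_ge0.
Qed.

(** The primitive below differs from - x exp (- x^2) / 2 by half of the Gauss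
    integral up to x, so that the integrand is nonnegative and the fundamental
    theorem of calculus applies on the whole half-line. *)
Lemma integral0y_sqr_gauss (R : realType) :
  (\int[lebesgue_measure]_(x in `[0%R, +oo[) (x ^+ 2 * gauss_fun x)%:E
    = (Num.sqrt pi / 4 : R)%:E)%E.
Proof.
pose F (x : R) :=
  (gauss_integral_proof.integral0_gauss x - x * gauss_fun x) / 2.
have ig (a b : R) : lebesgue_measure.-integrable `[a, b] (EFin \o gauss_fun).
  by apply: integrableS integrableT_gauss.
have dF (x : R) : 0 < x -> is_derive x 1 F (x ^+ 2 * gauss_fun x).
  move=> x0.
  have [dI I'] := @continuous_FTC1_closed R gauss_fun 0 x (x + 1) ltac:(lra)
    (ig 0 (x + 1)) x0 (@continuous_gauss_fun R x).
  have DI : is_derive x 1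
      (@gauss_integral_proof.integral0_gauss R) (gauss_fun x).
    by rewrite derive1E in I'; exact: DeriveDef dI I'.
  have Dg : is_derive x 1 (@gauss_fun R) (- (2 * x) * gauss_fun x).
    have D2 : is_derive x 1 (fun x : R => - x ^+ 2) (- (2 * x)).
      by apply: is_derive_eq; rewrite /GRing.scale/=; ring.
    have H := @is_derive1_comp R expR (fun x => - x ^+ 2) x _ _
      (is_derive_expR _) D2.
    by apply: is_derive_eq; rewrite /gauss_fun mulrC.
  rewrite /F; apply: is_derive_eq.
  by rewrite /GRing.scale/=; field.
rewrite (@ge0_continuous_FTC2y _ _ F 0 (Num.sqrt pi / 4)).
- rewrite /F mul0r subr0 /gauss_integral_proof.integral0_gauss.
  by rewrite set_itv1 Rintegral_set1 mul0r sube0.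
- by move=> x _; rewrite mulr_ge0 ?sqr_ge0 ?gauss_fun_ge0.
- apply: continuous_subspaceT => x; apply: cvgM; first exact: sqr_continuous.
  exact: continuous_gauss_fun.
- rewrite (_ : Num.sqrt pi / 4 = (Num.sqrt pi / 2 - 0) / 2); last by field.
  apply: cvgMr_tmp; apply: cvgB; first exact: cvg_integral0_gauss.
  exact: cvg_x_gauss_fun.
- by move=> x x0; have [] := dF x x0.
- apply: cvgMr_tmp; apply: cvgB.
    have :=
      @parameterized_integral_continuous R 0 1 gauss_fun ler01 (ig 0 1).
    move=> /continuous_within_itvP -/(_ ltr01) [_ + _].
    exact.
  apply: cvg_at_right_filter; apply: cvgM; first exact: cvg_id.
  exact: continuous_gauss_fun.
- move=> x; rewrite in_itv/= andbT => x0.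
  by have [_ <-] := dF x x0; rewrite derive1E.
Qed.

Lemma integralT_sqr_gauss (R : realType) :
  (\int[lebesgue_measure]_x (x ^+ 2 * gauss_fun x)%:E =
   (Num.sqrt pi / 2 : R)%:E)%E.
Proof.
rewrite (@ge0_symfun_integralT _ (fun x => x ^+ 2 * gauss_fun x)).
- rewrite (_ : [set x | _] = `[0, +oo[%classic); last first.
    by apply/seteqP; split => x/=; rewrite in_itv/= andbT.
  by rewrite integral0y_sqr_gauss -EFinM; congr EFin; field.
- by move=> x; rewrite mulr_ge0 ?sqr_ge0 ?gauss_fun_ge0.
- move=> x; apply: cvgM; first exact: sqr_continuous.
  exact: continuous_gauss_fun.
- by move=> x /=; rewrite /gauss_fun sqrrN.
Qed.

Lemma integrableT_sqr_gauss (R : realType) :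
  lebesgue_measure.-integrable [set: R] (fun x => (x ^+ 2 * gauss_fun x)%:E).
Proof.
apply/integrableP; split.
  apply/measurable_EFinP; apply: continuous_measurable_fun => x.
  by apply: cvgM; [exact: sqr_continuous|exact: continuous_gauss_fun].
rewrite [ltLHS](_ : _ = (Num.sqrt pi / 2)%:E) ?ltry// -integralT_sqr_gauss.
apply: eq_integral => x _.
by rewrite /= ger0_norm// mulr_ge0 ?sqr_ge0 ?gauss_fun_ge0.
Qed.

(** The cross term 2 a b x disappears when the integral is added to its image
    under x -> - x. *)
Lemma integralT_affine_sqr_gauss (R : realType) (a b : R) :
  (\int[lebesgue_measure]_x ((a + b * x) ^+ 2 * gauss_fun x)%:E
   = (Num.sqrt pi * (a ^+ 2 + b ^+ 2 / 2))%:E)%E.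
Proof.
have c1 : continuous (fun x : R => (a + b * x) ^+ 2 * gauss_fun x).
  move=> x; apply: cvgM; last exact: continuous_gauss_fun.
  apply: (@cvg_comp _ _ _ (fun x => a + b * x) (fun x => x ^+ 2) _
    (nbhs (a + b * x))).
    by apply: cvgD; [exact: cvg_cst|apply: cvgMl_tmp; exact: cvg_id].
  exact: sqr_continuous.
have cq (p q : R) : (\int[lebesgue_measure]_x
     ((p * gauss_fun x)%:E + (q * (x ^+ 2 * gauss_fun x))%:E)
   = (Num.sqrt pi * (p + q / 2))%:E)%E.
  have i1 : lebesgue_measure.-integrable [set: R]
      (fun x => (p * gauss_fun x)%:E).
    under eq_fun do rewrite EFinM.
    by apply: integrableZl => //; exact: integrableT_gauss.
  have i2 : lebesgue_measure.-integrable [set: R]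
      (fun x => (q * (x ^+ 2 * gauss_fun x))%:E).
    under eq_fun do rewrite EFinM.
    by apply: integrableZl => //; exact: integrableT_sqr_gauss.
  rewrite integralD//.
  under eq_integral do rewrite EFinM.
  rewrite integralZl//; last exact: integrableT_gauss.
  under [X in (_ + X)%E]eq_integral do rewrite EFinM.
  rewrite integralZl//; last exact: integrableT_sqr_gauss.
  rewrite integralT_gauss integralT_sqr_gauss -!EFinM -EFinD.
  by congr EFin; ring.
have pos (x : R) : (0 <= ((a + b * x) ^+ 2 * gauss_fun x)%:E)%E.
  by rewrite lee_fin mulr_ge0 ?sqr_ge0 ?gauss_fun_ge0.
have mea : measurable_fun setT
    (fun x : R => ((a + b * x) ^+ 2 * gauss_fun x)%:E).
  by apply/measurable_EFinP; exact: continuous_measurable_fun.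
have mopp :
    measurable_fun setT (-%R : measurableTypeR R -> measurableTypeR R).
  by apply: continuous_measurable_fun => x; exact: opp_continuous.
have refl : (\int[lebesgue_measure]_x ((a + b * x) ^+ 2 * gauss_fun x)%:E =
  \int[lebesgue_measure]_x ((a + b * (- x)) ^+ 2 * gauss_fun (- x))%:E)%E.
  transitivity (\int[pushforward lebesgue_measure
      (-%R : measurableTypeR R -> measurableTypeR R)]_x
        ((a + b * x) ^+ 2 * gauss_fun x)%:E)%E.
    by apply: eq_measure_integral => A mA _; rewrite -[LHS]lebesgue_measureN.
  by rewrite ge0_integral_pushforward.
suff : (2%:E * \int[lebesgue_measure]_x ((a + b * x) ^+ 2 * gauss_fun x)%:E
   = 2%:E * (Num.sqrt pi * (a ^+ 2 + b ^+ 2 / 2))%:E)%E.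
  have half : (1 = (2^-1 : R)%:E * 2%:E :> \bar R)%E by rewrite -EFinM mulVf.
  by move=> E2; rewrite -[LHS]mul1e -[RHS]mul1e half -!muleA E2.
rewrite mule_natl mule2n {2}refl -ge0_integralD//;
  last exact: (measurableT_comp mea).
transitivity (\int[lebesgue_measure]_x (((2 * a ^+ 2) * gauss_fun x)%:E +
    ((2 * b ^+ 2) * (x ^+ 2 * gauss_fun x))%:E))%E.
  apply: eq_integral => x _; rewrite -!EFinD; congr EFin.
  by rewrite {2}/gauss_fun sqrrN -/(gauss_fun x); ring.
by rewrite cq -EFinM; congr EFin; ring.
Qed.

Lemma integral_affine_sqr_normal (R : realType) (p c w m : R) : 0 < p ->
  (\int[lebesgue_measure]_t
     ((c + w * (t + m)) ^+ 2 * expR (- (1 / 2) * (p * (t + m) ^+ 2)))%:E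
   = (Num.sqrt (2 * pi / p) * (c ^+ 2 + w ^+ 2 / p))%:E)%E.
Proof.
move=> p0; pose s : R := Num.sqrt (2 / p).
have s2 : s ^+ 2 = 2 / p by rewrite sqr_sqrtr// divr_ge0// ltW.
have s0 : 0 < s by rewrite sqrtr_gt0 divr_gt0.
(* F x + m = s x, and p (s x)^2 / 2 = x^2. *)
pose F (x : R) : R := (x - m / s) * s.
have DF (x : R) : is_derive x 1 F s.
  by rewrite /F; apply: is_derive_eq; rewrite /GRing.scale/=; ring.
have F' : F^`()%classic = cst s.
  by apply/funext => x; have [_ <-] := DF x; rewrite derive1E.
rewrite (@increasing_ge0_integration_by_substitutionT _ F); first last.
- by move=> x; rewrite mulr_ge0 ?sqr_ge0 ?expR_ge0.
- move=> x; apply: cvgM.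
    apply: (@cvg_comp _ _ _ (fun x => c + w * (x + m)) (fun x => x ^+ 2) _
      (nbhs (c + w * (x + m)))).
      apply: cvgD; [exact: cvg_cst|apply: cvgMl_tmp].
      by apply: cvgD; [exact: cvg_id|exact: cvg_cst].
    exact: sqr_continuous.
  apply: (@cvg_comp _ _ _ _ expR _ (nbhs (- (1 / 2) * (p * (x + m) ^+ 2))));
    last exact: continuous_expR.
  do 2 apply: cvgMl_tmp.
  apply: (@cvg_comp _ _ _ (fun x => x + m) (fun x => x ^+ 2) _
    (nbhs (x + m))).
    by apply: cvgD; [exact: cvg_id|exact: cvg_cst].
  exact: sqr_continuous.
- by apply/gt0_cvgMly; last exact: cvg_addrr.
- by apply/gt0_cvgMlNy; last exact: cvg_addrr_Ny.
- by move=> x; have [] := DF x.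
- by rewrite F'; exact: is_cvg_cst.
- by rewrite F'; exact: is_cvg_cst.
- by rewrite F' => x; exact: cvg_cst.
- by move=> x y xy; rewrite /F ltr_pM2r// ltrD2r.
transitivity (\int[lebesgue_measure]_x
    (s%:E * ((c + (w * s) * x) ^+ 2 * gauss_fun x)%:E))%E.
  apply: eq_integral => x _; rewrite F' -EFinM; congr EFin.
  rewrite !fctE /= mulrC.
  have -> : F x + m = s * x by rewrite /F; field; lra.
  rewrite mulrA /gauss_fun; congr (s * (_ * expR _)).
  by rewrite exprMn s2; field; lra.
rewrite ge0_integralZl//; last 3 first.
- apply/measurable_EFinP; apply: measurable_funM;
    last exact: measurable_gauss_fun.
  by apply: measurable_funX; apply: measurable_funD => //;
    exact: measurable_funM.
- by move=> x _; rewrite lee_fin mulr_ge0 ?sqr_ge0 ?gauss_fun_ge0.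
- by rewrite lee_fin ltW.
rewrite integralT_affine_sqr_gauss -EFinM; congr EFin.
rewrite exprMn s2 mulrA; congr (_ * _); last by field; lra.
by rewrite /s -sqrtrM ?divr_ge0 ?ltW//; congr (Num.sqrt _); ring.
Qed.

Lemma measurable_quad_form (R : realType) n (P : 'M[R]_n) d
    (T : measurableType d) (f : T -> 'rV[R]_n) :
  measurable_fun setT f ->
  measurable_fun setT (fun y => (f y *m P *m (f y)^T) 0 0).
Proof.
move=> mf; apply: measurableT_comp (measurable_fun_coord _ _) _.
apply: measurable_mulmx; last exact: measurable_trmx.
by apply: measurable_mulmx => //; exact: measurable_cst.
Qed.

Lemma measurable_affine_sqr_expR (R : realType) n (P : 'M[R]_n) (c : R)
    (w : 'rV[R]_n) :
  measurable_fun [set: 'rV[R]_n] (fun y : 'rV[R]_n =>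
    ((c + (y *m w^T) 0 0) ^+ 2 *
     expR (- (1 / 2) * (y *m P *m y^T) 0 0))%:E).
Proof.
apply/measurable_EFinP; apply: measurable_funM.
  apply: measurable_funX; apply: measurable_funD; first exact: measurable_cst.
  apply: measurableT_comp (measurable_fun_coord _ _) _.
  by apply: measurable_mulmx; [exact: measurable_id|exact: measurable_cst].
apply: measurableT_comp => //; apply: measurable_funM => //.
exact: measurable_quad_form.
Qed.

(** * The Schur complement of the top left entry *)

Definition schur (R : fieldType) n (P : 'M[R]_(1 + n)) : 'M[R]_n :=
  drsubmx P - (P 0 0)^-1 *: (dlsubmx P *m ursubmx P).

Lemma ulsubmx11 (R : fieldType) n (P : 'M[R]_(1 + n)) : ulsubmx P = (P 0 0)%:M.
Proof.
apply/matrixP => i j; rewrite !ord1 !mxE eqxx mulr1n.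
by congr (P _ _); apply/val_inj.
Qed.

(** Block elimination: P is a unipotent block matrix times a block triangular
    one with diagonal P_00, schur P. *)
Lemma det_schur (R : fieldType) n (P : 'M[R]_(1 + n)) : P 0 0 != 0 ->
  \det P = P 0 0 * \det (schur P).
Proof.
move=> p0; rewrite -{1}(submxK P).
have -> : block_mx (ulsubmx P) (ursubmx P) (dlsubmx P) (drsubmx P) =
  block_mx 1%:M 0 ((P 0 0)^-1 *: dlsubmx P) 1%:M *m
  block_mx (P 0 0)%:M (ursubmx P) 0 (schur P).
  rewrite mulmx_block !mul1mx !mul0mx !addr0 ulsubmx11; congr block_mx.
    by rewrite -scalemxAl mul_mx_scalar scalerA mulVf// scale1r.
  by rewrite -scalemxAl /schur addrC subrK.
by rewrite det_mulmx det_lblock det_ublock !det1 !mul1r det_scalar1.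
Qed.

(** The shift of x by <z, b> / P_00, with b the rest of the first row of P,
    absorbs the cross terms of the quadratic form. *)
Lemma complete_square (R : fieldType) n (P : 'M[R]_(1 + n)) (x : R)
    (z : 'rV[R]_n) :
  P^T = P -> P 0 0 != 0 ->
  ((row_mx x%:M z : 'rV_(1 + n)) *m P *m (row_mx x%:M z)^T) 0 0 =
  P 0 0 * (x + (z *m (ursubmx P)^T) 0 0 / P 0 0) ^+ 2 +
  (z *m schur P *m z^T) 0 0.
Proof.
move=> symP p0; have Edl : dlsubmx P = (ursubmx P)^T by rewrite trmx_ursub symP.
rewrite -{1}(submxK P) ulsubmx11 mul_row_block tr_row_mx mul_row_col.
rewrite /schur Edl; set b := ursubmx P; set D := drsubmx P; set p := P 0 0.
have bz : b *m z^T = (z *m b^T)^T by rewrite trmx_mul trmxK.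
have := mx11_scalar (z *m b^T); set beta := (z *m b^T) 0 0 => zb.
rewrite mulmxBr mulmxBl -scalemxAr -scalemxAl !mulmxDl !mulmxA zb.
rewrite -[X in _ - p^-1 *: X]mulmxA -[x%:M *m b *m z^T]mulmxA bz zb.
by rewrite !tr_scalar_mx -!scalar_mxM !mxE eqxx !mulr1n; field.
Qed.

Lemma row_mx_head (R : pzRingType) n (v : 'rV[R]_(1 + n)) :
  v = row_mx (v 0 0)%:M (rsubmx v).
Proof.
rewrite -[LHS]hsubmxK; congr row_mx.
apply/rowP => i; rewrite ord1 !mxE eqxx mulr1n.
by congr (v _ _); apply/val_inj.
Qed.

Lemma schur_sym (R : fieldType) n (P : 'M[R]_(1 + n)) : P^T = P ->
  (schur P)^T = schur P.
Proof.
move=> symP; rewrite /schur linearB linearZ/= trmx_mul.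
by rewrite trmx_drsub trmx_dlsub trmx_ursub symP.
Qed.

Lemma posdef_diag_gt0 (R : realType) n (A : 'M[R]_n) (i : 'I_n) :
  posdefmx A -> 0 < A i i.
Proof.
move=> pd; have := pd (delta_mx 0 i).
rewrite -rowE trmx_delta -colE !mxE; apply.
apply/eqP => /matrixP/(_ 0 i)/eqP; rewrite !mxE !eqxx.
by rewrite oner_eq0.
Qed.

Lemma posdef_trace_ge0 (R : realType) n (A : 'M[R]_n) :
  posdefmx A -> 0 <= \tr A.
Proof. by move=> pd; apply: sumr_ge0 => i _; rewrite ltW// posdef_diag_gt0. Qed.

(** The vector extending z whose first coordinate makes the completed square
    vanish reduces the quadratic form of P to that of its Schur complement. *)
Lemma posdef_schur (R : realType) n (P : 'M[R]_(1 + n)) : P^T = P ->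
  posdefmx P -> posdefmx (schur P).
Proof.
move=> symP pd z z0; have p0 := posdef_diag_gt0 0 pd.
pose v : 'rV[R]_(1 + n) := row_mx (- ((z *m (ursubmx P)^T) 0 0 / P 0 0))%:M z.
have := pd v; rewrite complete_square ?gt_eqF// addNr expr0n/= mulr0 add0r.
apply; apply: contra z0 => /eqP v0; apply/eqP.
by have := congr1 rsubmx v0; rewrite /v row_mxKr linear0.
Qed.

(** The same shift of x turns the linear form <y, (q0, q) P> into a multiple of
    the shifted variable plus the linear form <z, q S> of the same kind for the
    Schur complement S. This is why the linear forms in
    [gaussian_quadratic_integral] are parametrized by q rather than by q P: the
    induction hypothesis then applies without inverting P. *)
Lemma schur_linear_form (R : fieldType) n (P : 'M[R]_(1 + n)) (x q0 : R)
    (z q : 'rV[R]_n) : P^T = P -> P 0 0 != 0 ->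
  ((row_mx x%:M z : 'rV_(1 + n)) *m (row_mx q0%:M q *m P)^T) 0 0 =
  (z *m (q *m schur P)^T) 0 0 + (q0 * P 0 0 + (q *m (ursubmx P)^T) 0 0) *
    (x + (z *m (ursubmx P)^T) 0 0 / P 0 0).
Proof.
move=> symP p0; have Edl : dlsubmx P = (ursubmx P)^T by rewrite trmx_ursub symP.
rewrite -{1}(submxK P) ulsubmx11 Edl.
rewrite mul_row_block tr_row_mx mul_row_col /schur Edl.
set b := ursubmx P; set D := drsubmx P; set p := P 0 0.
have qb : q *m b^T = ((q *m b^T) 0 0)%:M by exact: mx11_scalar.
move: qb; set gam := (q *m b^T) 0 0 => qb.
rewrite qb mulmxBr -scalemxAr mulmxA qb !mul_scalar_mx !scalerA.
rewrite [(q *m D - _)^T]linearB [(_ + q *m D)^T]linearD/=.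
rewrite ![(_ *: b)^T]linearZ/= !mulmxDr !mulmxN -!scalemxAr.
by rewrite !mxE eqxx !mulr1n; field.
Qed.

(** * The Gaussian distribution on row vectors *)

(** The determinant is positive because each passage to the Schur complement
    splits a positive factor P_00 off it. *)
Lemma gaussian_quadratic_integral (R : realType) n (P : 'M[R]_n) :
  P^T = P -> posdefmx P -> 0 < \det P /\ forall (c : R) (q : 'rV[R]_n),
  (\int[@lebesgue_rV R n]_y ((c + (y *m (q *m P)^T) 0 0) ^+ 2 *
     expR (- (1 / 2) * (y *m P *m y^T) 0 0))%:E =
   (Num.sqrt ((2 * pi) ^+ n / \det P) * (c ^+ 2 + (q *m P *m q^T) 0 0))%:E)%E.
Proof.
elim: n P => [|n IH] P symP pd.
  rewrite det_mx00; split => // c q; rewrite integral_rV0;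
    last exact: measurable_affine_sqr_expR.
  rewrite (flatmx0 P) !mulmx0 !mul0mx !mxE expr0 divr1 sqrtr1 mulr0 expR0.
  by rewrite mul1r mulr1 !addr0.
have {symP pd}[symP pd] :
    (P : 'M[R]_(1 + n))^T = P /\ posdefmx (P : 'M[R]_(1 + n)) by [].
have p0 := posdef_diag_gt0 0 pd.
have [detS {}IH] := IH (schur (P : 'M[R]_(1 + n))) (schur_sym symP)
  (posdef_schur symP pd).
have detP := @det_schur R n P (lt0r_neq0 p0).
split; first by rewrite detP mulr_gt0.
move=> c q; rewrite ge0_integral_rVS; last 2 first.
- exact: measurable_affine_sqr_expR.
- by move=> y; rewrite lee_fin mulr_ge0 ?sqr_ge0 ?expR_ge0.
move: p0 detP; set p := (P : 'M[R]_(1 + n)) 0 0 => p0 detP.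
set S := schur P in detS IH detP *.
pose q0 := (q : 'rV[R]_(1 + n)) 0 0; pose q' := rsubmx (q : 'rV[R]_(1 + n)).
have Eq := row_mx_head (q : 'rV[R]_(1 + n)); rewrite -/q0 -/q' in Eq.
pose b := ursubmx (P : 'M[R]_(1 + n)).
pose w0 := q0 * p + (q' *m b^T) 0 0.
pose I (k : R) (r z : 'rV[R]_n) := (k + (z *m (r *m S)^T) 0 0) ^+ 2 *
  expR (- (1 / 2) * (z *m S *m z^T) 0 0).
have I0 k r z : (0 <= (I k r z)%:E)%E.
  by rewrite lee_fin mulr_ge0 ?sqr_ge0 ?expR_ge0.
have mI k r : measurable_fun [set: 'rV[R]_n] (fun z => (I k r z)%:E).
  exact: measurable_affine_sqr_expR.
have [mu E] := @lebesgue_rV_sigma_finite R n.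
have {}IH k r : (\int[mu]_z (I k r z)%:E =
    (Num.sqrt ((2 * pi) ^+ n / \det S) * (k ^+ 2 + (r *m S *m r^T) 0 0))%:E)%E.
  by rewrite -IH E.
rewrite E.
(* Integrating out x leaves k^2 + w0^2 / p, where k = c + <z, q' S>; the second
   summand is again of the form I, for the constant w0 / sqrt p and q = 0. *)
transitivity (\int[mu]_z ((Num.sqrt (2 * pi / p))%:E *
    ((I c q' z)%:E + (I (w0 / Num.sqrt p) 0 z)%:E)))%E.
  apply: eq_integral => z _.
  pose m := (z *m b^T) 0 0 / p.
  transitivity (\int[lebesgue_measure]_x
    ((expR (- (1 / 2) * (z *m S *m z^T) 0 0))%:E *
     ((c + (z *m (q' *m S)^T) 0 0 + w0 * (x + m)) ^+ 2 *
       expR (- (1 / 2) * (p * (x + m) ^+ 2)))%:E))%E.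
    apply: eq_integral => x _; rewrite Eq schur_linear_form ?gt_eqF//.
    rewrite complete_square ?gt_eqF// -EFinM -/S -/p -/b -/m -/w0.
    rewrite /= [- (1 / 2) * (_ + _)]mulrDr expRD [c + (_ + _)]addrA.
    by congr EFin; ring.
  rewrite ge0_integralZl//; last 2 first.
  - apply/measurable_EFinP; apply: measurable_funM.
      apply: measurable_funX; apply: measurable_funD => //.
      by apply: measurable_funM => //; exact: measurable_funD.
    apply: measurableT_comp => //; do 2 apply: measurable_funM => //.
    by apply: measurable_funX; exact: measurable_funD.
  - by move=> x _; rewrite lee_fin mulr_ge0 ?sqr_ge0 ?expR_ge0.
  rewrite integral_affine_sqr_normal// -EFinD -!EFinM; congr EFin.
  rewrite /I; have -> : (z *m ((0 : 'rV[R]_n) *m S)^T) 0 0 = 0.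
    by rewrite mul0mx linear0 mulmx0 mxE.
  rewrite addr0 [(w0 / _) ^+ 2]exprMn exprVn sqr_sqrtr ?ltW//.
  by ring.
rewrite ge0_integralZl//; last 2 first.
- exact: emeasurable_funD.
- by move=> z _; rewrite adde_ge0.
rewrite ge0_integralD//.
have Z : ((0 : 'rV[R]_n) *m S *m (0 : 'rV[R]_n)^T) 0 0 = 0.
  by rewrite !mul0mx mxE.
rewrite !IH Z addr0 -EFinD -EFinM; congr EFin.
rewrite -mulrDr mulrA -sqrtrM; last by rewrite divr_ge0 ?mulr_ge0 ?pi_ge0 ?ltW.
congr (Num.sqrt _ * _).
  by rewrite detP exprS; field; rewrite !gt_eqF.
rewrite -addrA; congr (_ + _).
rewrite Eq complete_square ?gt_eqF// -/p -/b -/S.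
by rewrite addrC exprMn exprVn sqr_sqrtr ?ltW// /w0; field; rewrite gt_eqF.
Qed.

(** The library's Radon-Nikodym derivative of the measure with density p agrees
    with p almost everywhere, so its change of variables formula applies to
    p. *)
Lemma density_probability d (T : measurableType d) (R : realType)
    (mu : {sigma_finite_measure set T -> \bar R}) (p : T -> R) :
  measurable_fun setT p -> (forall x, 0 <= p x) ->
  (\int[mu]_x (p x)%:E = 1)%E ->
  exists2 P : probability T R, (fun A => \int[mu]_(x in A) (p x)%:E)%E = P &
    forall f : T -> \bar R, measurable_fun setT f -> (forall x, 0 <= f x)%E ->
      (\int[P]_x f x = \int[mu]_x (f x * (p x)%:E))%E.
Proof.
move=> mp p0 p1; pose nu (A : set T) : \bar R := (\int[mu]_(x in A) (p x)%:E)%E.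
have mp' : measurable_fun setT (EFin \o p) by exact/measurable_EFinP.
have nu0 : nu set0 = 0%E by rewrite /nu integral_set0.
have nu_ge0 A : (0 <= nu A)%E by apply: integral_ge0 => x _; rewrite lee_fin.
have nuA : semi_sigma_additive nu.
  move=> F mF tF mUF; rewrite /nu ge0_integral_bigcup//=.
  - by apply: is_cvg_ereal_nneg_natsum_cond => n _ _; exact: nu_ge0.
  - exact: measurable_funTS.
  - by move=> x _; rewrite lee_fin.
pose M : {measure set T -> \bar R} := HB.pack nu
  (isMeasure.Build _ _ _ nu nu0 nu_ge0 nuA).
have M1 : M setT = 1%E by exact: p1.
pose P : probability T R := HB.pack (Measure.sort M)
  (Measure_isProbability.Build _ _ _ (Measure.sort M) M1).
exists P => // f mf f0.
have Pmu : P `<< mu.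
  apply/null_content_dominatesP => A mA muA0.
  by apply: null_set_integral => //; exact: measurable_funTS.
rewrite -(Radon_Nikodym_SigmaFinite.change_of_variables Pmu)//.
apply: ae_eq_integral => //.
- apply: emeasurable_funM => //.
  exact: measurable_int (Radon_Nikodym_SigmaFinite.f_integrable _).
- exact: emeasurable_funM.
apply: ae_eqe_mul2l; apply: integral_ae_eq => //.
- exact: Radon_Nikodym_SigmaFinite.f_integrable.
- by move=> A _ mA; rewrite -Radon_Nikodym_SigmaFinite.f_integral.
Qed.

Lemma posdef_unitmx (R : realType) n (A : 'M[R]_n) : posdefmx A -> A \in unitmx.
Proof.
move=> pd; rewrite -row_free_unit -kermx_eq0; apply: contraT => /rowV0Pn[v].
by move=> /sub_kermxP vA /pd; rewrite vA mul0mx mxE ltxx.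
Qed.

Lemma posdef_invmx (R : realType) n (A : 'M[R]_n) : A^T = A -> posdefmx A ->
  posdefmx (invmx A).
Proof.
move=> symA pd v v0; have uA := posdef_unitmx pd.
have := pd (v *m invmx A); rewrite trmx_mul trmx_inv symA mulmxKV// mulmxA.
apply; apply: contra v0 => /eqP vA0.
by rewrite -[v](mulmxKV uA) vA0 mul0mx.
Qed.

Lemma enorm_sqr (R : realType) n (v : 'rV[R]_n) :
  enorm v ^+ 2 = \sum_(i < n) v 0 i ^+ 2.
Proof. by rewrite sqr_sqrtr// sumr_ge0// => i _; rewrite sqr_ge0. Qed.

Lemma measurable_gauss_pdf (R : realType) n (Gam : 'M[R]_n) :
  measurable_fun setT (gauss_pdf Gam).
Proof.
apply: measurable_funM => //; apply: measurableT_comp => //.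
by apply: measurable_funM => //; exact: measurable_quad_form.
Qed.

Lemma measurable_enorm_sqr (R : realType) n d (T : measurableType d)
    (f : T -> 'rV[R]_n) :
  measurable_fun setT f -> measurable_fun setT (fun x => enorm (f x) ^+ 2).
Proof.
move=> mf; under eq_fun do rewrite enorm_sqr.
apply: measurable_sum => i; apply: measurable_funX.
exact: measurableT_comp (measurable_fun_coord _ _) _.
Qed.

(** This is [gaussian_quadratic_integral] for P = Gam^-1 and q = w Gam, where
    the factor sqrt ((2 pi)^n det Gam) cancels the normalization of the
    density. *)
Lemma gauss_moments (R : realType) n (Gam : 'M[R]_n) (c : R) (w : 'rV[R]_n) :
  Gam^T = Gam -> posdefmx Gam ->
  (\int[@lebesgue_rV R n]_y
     (((c + (y *m w^T) 0 0) ^+ 2)%:E * (gauss_pdf Gam y)%:E) =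
   (c ^+ 2 + (w *m Gam *m w^T) 0 0)%:E)%E.
Proof.
move=> symG pd; have uG := posdef_unitmx pd.
have symI : (invmx Gam)^T = invmx Gam by rewrite trmx_inv symG.
have [detI int] := gaussian_quadratic_integral symI (posdef_invmx symG pd).
have := int c (w *m Gam); rewrite mulmxK// => {}int.
have detG : 0 < \det Gam by move: detI; rewrite det_inv invr_gt0.
have N0 : 0 < Num.sqrt ((2 * pi) ^+ n * \det Gam).
  by rewrite sqrtr_gt0 mulr_gt0// exprn_gt0// mulr_gt0// pi_gt0.
have [mu E] := @lebesgue_rV_sigma_finite R n; rewrite E in int *.
transitivity (\int[mu]_y ((Num.sqrt ((2 * pi) ^+ n * \det Gam))^-1%:E *
   ((c + (y *m w^T) 0 0) ^+ 2 *
      expR (- (1 / 2) * (y *m invmx Gam *m y^T) 0 0))%:E))%E.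
  by apply: eq_integral => y _; rewrite -!EFinM /gauss_pdf mulrCA.
rewrite ge0_integralZl//; last 2 first.
- exact: measurable_affine_sqr_expR.
- by move=> y _; rewrite lee_fin mulr_ge0 ?sqr_ge0 ?expR_ge0.
rewrite int -EFinM det_inv invrK mulrA mulVf ?gt_eqF// mul1r.
by rewrite trmx_mul symG mulmxA.
Qed.

(** |u + y|^2 is the sum over i of (u_i + <y, e_i>)^2, whose Gaussian integral
    is u_i^2 + Gam_ii. *)
Lemma gauss_probability (R : realType) n (Gam : 'M[R]_n) :
  Gam^T = Gam -> posdefmx Gam ->
  exists2 G : probability 'rV[R]_n R, gauss Gam = G &
    forall u : 'rV[R]_n, (\int[G]_y (enorm (u + y) ^+ 2)%:E =
      (enorm u ^+ 2 + \tr Gam)%:E)%E.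
Proof.
move=> symG pd; have mom c w := @gauss_moments R n Gam c w symG pd.
have [mu E] := @lebesgue_rV_sigma_finite R n; rewrite E in mom.
have p0 y : 0 <= gauss_pdf Gam y by rewrite mulr_ge0 ?invr_ge0 ?expR_ge0.
have mp := measurable_gauss_pdf Gam.
have p1 : (\int[mu]_y (gauss_pdf Gam y)%:E = 1)%E.
  have := mom 1 0; rewrite !mul0mx mxE addr0 expr1n => <-.
  apply: eq_integral => y _.
  by rewrite linear0 mulmx0 mxE addr0 expr1n mul1e.
have [G EG dens] := density_probability mp p0 p1.
exists G => [|u]; first by rewrite /gauss E.
rewrite dens//; last 2 first.
- apply/measurable_EFinP; apply: measurable_enorm_sqr.
  by apply: measurable_addmx; [exact: measurable_cst|exact: measurable_id].
- by move=> y; rewrite lee_fin sqr_ge0.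
transitivity (\int[mu]_y \sum_(i < n)
   (((u 0 i + (y *m (delta_mx 0 i : 'rV[R]_n)^T) 0 0) ^+ 2)%:E *
    (gauss_pdf Gam y)%:E))%E.
  apply: eq_integral => y _; rewrite enorm_sqr -EFinM mulr_suml -sumEFin.
  apply: eq_bigr => i _; rewrite -EFinM; congr (_ ^+ 2 * _)%:E.
  by rewrite trmx_delta -colE !mxE.
rewrite ge0_integral_sum//; last 2 first.
- move=> i; apply: emeasurable_funM; last exact/measurable_EFinP.
  apply/measurable_EFinP; apply: measurable_funX; apply: measurable_funD => //.
  apply: measurableT_comp (measurable_fun_coord _ _) _.
  by apply: measurable_mulmx; [exact: measurable_id|exact: measurable_cst].
- by move=> i y _; rewrite mule_ge0// lee_fin ?sqr_ge0.
under eq_bigr do rewrite mom.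
rewrite sumEFin big_split/= -enorm_sqr; congr (_ + _)%:E.
by apply: eq_bigr => i _; rewrite -rowE trmx_delta -colE !mxE.
Qed.

(** * Averaging a test function over the observation noise *)

Lemma enorm_row_mx_sqr (R : realType) m n (u : 'rV[R]_m) (v : 'rV[R]_n) :
  enorm (row_mx u v) ^+ 2 = enorm u ^+ 2 + enorm v ^+ 2.
Proof.
rewrite !enorm_sqr big_split_ord/=; congr (_ + _); apply: eq_bigr => i _.
  by rewrite row_mxEl.
by rewrite row_mxEr.
Qed.

Lemma measurable_gfun (R : realType) n d (T : measurableType d)
    (f : T -> 'rV[R]_n) :
  measurable_fun setT f -> measurable_fun setT (fun x => (gfun (f x))%:E).
Proof.
move=> mf; apply/measurable_EFinP; apply: measurable_funD => //.
exact: measurable_enorm_sqr.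
Qed.

Lemma gfun_gt0 (R : realType) n (v : 'rV[R]_n) : 0 < gfun v.
Proof. by rewrite ltr_wpDr ?sqr_ge0. Qed.

Lemma integrable_gfun (R : realType) n (mu : probability 'rV[R]_n R) :
  P2 mu -> mu.-integrable setT (fun v => (gfun v)%:E).
Proof.
move=> mu2; apply/integrableP; split; first exact: measurable_gfun.
under eq_integral do rewrite /= ger0_norm ?ltW ?gfun_gt0// EFinD.
rewrite ge0_integralD//; last 2 first.
- by move=> x _; rewrite lee_fin sqr_ge0.
- by apply/measurable_EFinP; exact: measurable_enorm_sqr.
rewrite integral_cst// mul1e lte_add_pinfty//.
by rewrite [ltLHS]probability_setT ltry.
Qed.

Lemma integrable_le_gfun (R : realType) n (mu : probability 'rV[R]_n R)
    (f : 'rV[R]_n -> R) :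
  P2 mu -> measurable_fun setT f -> (forall v, `|f v| <= gfun v) ->
  mu.-integrable setT (EFin \o f).
Proof.
move=> mu2 mf fg; apply: le_integrable (integrable_gfun mu2) => //.
  exact/measurable_EFinP.
by move=> v _; rewrite lee_fin (le_trans (fg v))// ler_norm.
Qed.

(** F u is the mean of f (u, h u + eta) divided by the constant of the bound. It
    does not depend on mu, so the same F serves for both laws in the theorem. *)
Lemma observation_average (R : realType) (d K : nat) (Gam : 'M[R]_K)
    (h : 'rV[R]_d -> 'rV[R]_K) (kappa : R) (f : 'rV[R]_(d + K) -> R) :
  Gam^T = Gam -> posdefmx Gam -> continuous h ->
  (forall u, enorm (h u) <= kappa) ->
  measurable_fun setT f -> (forall v, `|f v| <= gfun v) ->
  exists F : 'rV[R]_d -> R, [/\ measurable_fun setT F,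
    forall u, `|F u| <= gfun u &
    forall mu : probability 'rV[R]_d R, P2 mu ->
      (\int[Qop h Gam mu]_v (f v)%:E =
       (1 + kappa ^+ 2 + \tr Gam)%:E * \int[mu]_u (F u)%:E)%E].
Proof.
move=> symG pd hc hk mf fg.
have [G EG mom] := gauss_probability symG pd.
pose C := 1 + kappa ^+ 2 + \tr Gam.
have tr0 : 0 <= \tr Gam by exact: posdef_trace_ge0.
have C0 : 0 < C by rewrite /C -addrA ltr_wpDr// addr_ge0 ?sqr_ge0.
pose phi (p : 'rV[R]_d * 'rV[R]_K) : 'rV[R]_(d + K) := row_mx p.1 (h p.1 + p.2).
have mh := continuous_measurable_fun_mx hc.
have mphi : measurable_fun setT phi.
  apply: measurable_row_mx; first exact: measurable_fst.
  apply: measurable_addmx; last exact: measurable_snd.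
  exact: measurableT_comp mh measurable_fst.
have mphiu u : measurable_fun setT (fun y => phi (u, y)).
  exact: measurableT_comp mphi (measurable_pair1 u).
have mfphi : measurable_fun setT (fun p => (f (phi p))%:E).
  by apply/measurable_EFinP; exact: measurableT_comp mf mphi.
have intg u : (\int[G]_y (gfun (phi (u, y)))%:E <= (C * gfun u)%:E)%E.
  rewrite [leLHS](_ : _ = (gfun u + enorm (h u) ^+ 2 + \tr Gam)%:E);
    last first.
    transitivity (\int[G]_y ((gfun u)%:E + (enorm (h u + y) ^+ 2)%:E))%E.
      by apply: eq_integral => y _; rewrite -EFinD /gfun enorm_row_mx_sqr addrA.
    rewrite ge0_integralD//; last 3 first.
    - by move=> y _; rewrite lee_fin ltW ?gfun_gt0.
    - by move=> y _; rewrite lee_fin sqr_ge0.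
    - apply/measurable_EFinP; apply: measurable_enorm_sqr.
      by apply: measurable_addmx; [exact: measurable_cst|exact: measurable_id].
    rewrite integral_cst// [X in (_ * X)%E]probability_setT mule1 mom.
    by rewrite -EFinD addrA.
  rewrite lee_fin.
  have hk2 : enorm (h u) ^+ 2 <= kappa ^+ 2.
    by rewrite ler_sqr ?nnegrE ?sqrtr_ge0 ?(le_trans _ (hk u)) ?sqrtr_ge0.
  have g1 : 1 <= gfun u by rewrite lerDl sqr_ge0.
  have := sqr_ge0 kappa; rewrite /C; nra.
have absf u : (\int[G]_y `|(f (phi (u, y)))%:E| <= (C * gfun u)%:E)%E.
  apply: le_trans (intg u); apply: ge0_le_integral => //.
  - apply: measurableT_comp => //; apply/measurable_EFinP.
    exact: measurableT_comp mf (mphiu u).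
  - exact: measurable_gfun.
  - by move=> y _; rewrite lee_fin.
pose F u : \bar R := (\int[G]_y (f (phi (u, y)))%:E)%E.
have absF u : (`|F u| <= (C * gfun u)%:E)%E.
  apply: le_trans (absf u); apply: le_abse_integral => //.
  by apply/measurable_EFinP; exact: measurableT_comp mf (mphiu u).
have finF u : F u \is a fin_num.
  by rewrite fin_num_abs (le_lt_trans (absF u))// ltry.
have mF : measurable_fun setT F.
  have -> : F = (fun u => fubini_F G (fun p => (f (phi p))%:E)^\+ u -
                        fubini_F G (fun p => (f (phi p))%:E)^\- u)%E.
    apply/funext => u; rewrite /F integralE /fubini_F.
    by congr (_ - _)%E; apply: eq_integral => y _;
      rewrite ?funeposE ?funenegE.
  apply: emeasurable_funB; apply: measurable_fun_fubini_tonelli_F => //.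
  - exact: measurable_funepos.
  - exact: measurable_funeneg.
have mF' : measurable_fun setT (fun u => fine (F u) / C).
  by apply: measurable_funM => //; exact: measurableT_comp.
have leF' u : `|fine (F u) / C| <= gfun u.
  rewrite normrM [`|C^-1|]gtr0_norm ?invr_gt0// ler_pdivrMr// mulrC.
  by rewrite -lee_fin -abse_EFin fineK// absF.
exists (fun u => fine (F u) / C); split=> // mu mu2.
pose k p := (f (phi p))%:E.
have ik : (mu \x G)%E.-integrable setT k.
  apply/integrable12ltyP => //.
  have /integrableP[_] := integrableZl measurableT C (integrable_gfun mu2).
  apply: le_lt_trans; apply: ge0_le_integral => //.
  - by move=> u _; apply: integral_ge0.
  - apply: (measurable_fun_fubini_tonelli_F (abse \o k)) => //=.
    exact: measurableT_comp.
  - apply: measurableT_comp => //.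
    by apply: emeasurable_funM => //; exact: measurable_gfun.
  - move=> u _; apply: le_trans (absf u) _.
    by rewrite -EFinM lee_fin ler_norm.
transitivity (\int[mu \x G]_p k p)%E.
  rewrite /Qop EG integral_pushforward//; first exact/measurable_EFinP.
rewrite -integral12_prod_meas1//.
transitivity (\int[mu]_u (C%:E * (fine (F u) / C)%:E))%E.
  apply: eq_integral => u _.
  by rewrite -EFinM mulrC divfK ?gt_eqF// fineK.
by rewrite integralZl//; exact: integrable_le_gfun.
Qed.

Theorem lemma24 (R : realType) (d K : nat) (Gam : 'M[R]_K)
    (h : 'rV[R]_d -> 'rV[R]_K) (kappa : R)
    (Gam_sym : Gam^T = Gam) (Gam_posdef : posdefmx Gam)
    (h_cont : continuous h) (kappa_gt0 : 0 < kappa)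
    (h_bound : forall u : 'rV[R]_d, enorm (h u) <= kappa)
    (mu nu : probability 'rV[R]_d R) (mu_P2 : P2 mu) (nu_P2 : P2 nu) :
  (d_g (Qop h Gam mu) (Qop h Gam nu)
    <= (1 + kappa ^+ 2 + \tr Gam)%:E * d_g mu nu)%E.
Proof.
apply: ge_ereal_sup => _ [f [mf fg] <-].
have [F [mF Fg E]] :=
  observation_average Gam_sym Gam_posdef h_cont h_bound mf fg.
have fin (m : probability 'rV[R]_d R) :
    P2 m -> (\int[m]_u (F u)%:E)%E \is a fin_num.
  by move=> m2; apply: integrable_fin_num => //; exact: integrable_le_gfun.
rewrite !E// -muleBr// ?fin_num_adde_defr ?fin//.
have C0 : 0 <= 1 + kappa ^+ 2 + \tr Gam.
  by rewrite -addrA addr_ge0// addr_ge0 ?sqr_ge0// posdef_trace_ge0.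
rewrite abseM gee0_abs ?lee_fin//.
apply: lee_wpmul2l; first by rewrite lee_fin.
by apply: ereal_sup_ubound; exists F.
Qed.
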